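(* Let $F$ be a vector field on a Lie group $G$ with left-trivialization $f:G\to\mathfrak g$, $f(g)=g^{-1}\cdot F(g)$. Let $(g,\mu)$ be a solution curve of the left-trivialized adjoint system $$\dot g=F(g),\qquad \dot\mu=-g^*\cdot[Df(g)]^*\mu+\mathrm{ad}^*_{f(g)}\mu$$ on $G\times\mathfrak g^*$, and let $(g,\eta)$ be a solution curve of the left-trivialized variational system $$\dot g=F(g),\qquad \dot\eta=Df(g)\,(g\cdot\eta)-\mathrm{ad}_{f(g)}\eta$$ on $G\times\mathfrak g$, both covering the same base curve $g$. Let $(g,p)$, $p=g^{*-1}\cdot\mu$, and $(g,\delta g)$, $\delta g=g\cdot\eta$, be the respective solution curves of the adjoint system on $T^*G$ and of the variational system on $TG$ obtained by left translation. Then $$\frac{d}{dt}\langle\mu(t),\eta(t)\rangle=0,\qquad \frac{d}{dt}\langle p(t),\delta g(t)\rangle=0.$$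
   Context: All manifolds and maps are smooth. $\langle\cdot,\cdot\rangle$ is the duality pairing between $T_g^*G$ and $T_gG$ (in particular between $\mathfrak g^*$ and $\mathfrak g=T_eG$). With $L_g(x)=gx$: $g^{-1}\cdot v_g:=T_gL_{g^{-1}}(v_g)\in\mathfrak g$ for $v_g\in T_gG$; $g\cdot\xi:=T_eL_g(\xi)$ for $\xi\in\mathfrak g$; $g^*\cdot p_g:=T_e^*L_g(p_g)\in\mathfrak g^*$ (dual of $T_eL_g$) for $p_g\in T_g^*G$, with inverse $g^{*-1}:\mathfrak g^*\to T_g^*G$. $Df(g):T_gG\to\mathfrak g$ is the derivative of $f$, and $[Df(g)]^*:\mathfrak g^*\to T_g^*G$ its dual. $\mathrm{ad}_\xi\eta=[\xi,\eta]$, and $\langle\mathrm{ad}_\xi^*\mu,\eta\rangle=\langle\mu,\mathrm{ad}_\xi\eta\rangle$. The adjoint system on $T^*G$ is Hamilton's equations for $H(g,p)=\langle p,F(g)\rangle$ with the canonical symplectic form; in canonical coordinates, $\dot g=F(g)$, $\dot p=-DF(g)^*p$. The variational system on $TG$ is the linearization of $\dot g=F(g)$ along solutions; in coordinates, $\dot g=F(g)$, $\frac{d}{dt}\delta g=DF(g)\delta g$. *)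

(* Defs.v *)
From HB Require Import structures.
From mathcomp Require Import all_boot all_order all_algebra.
From mathcomp Require Import all_classical all_reals all_analysis.

Set Implicit Arguments.
Unset Strict Implicit.
Unset Printing Implicit Defensive.
Import Order.TTheory GRing.Theory Num.Theory.
Import numFieldNormedType.Exports.

Local Open Scope classical_set_scope.
Local Open Scope ring_scope.

(* Tangent vectors are row vectors and covectors are column vectors. *)
Definition pairing (R : realType) n (p : 'cV[R]_n) (v : 'rV[R]_n) : R :=
  \sum_(i < n) p i 0 * v 0 i.

(* The dual of a linear map A, so that <dual A p, v> = <p, A v>. *)
Definition dual (R : realType) m n (A : 'rV[R]_m -> 'rV[R]_n) (p : 'cV[R]_n) :
    'cV[R]_m :=
  \col_i pairing p (A (delta_mx 0 i)).

(* For finite-dimensional U and open A, [Ck k A f] says that f is of class C^k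
   on A. *)
Fixpoint Ck (R : realType) (U W : normedModType R) (k : nat) (A : set U)
    (f : U -> W) : Prop :=
  match k with
  | 0 => forall x, A x -> {for x, continuous f}
  | k'.+1 => (forall x, A x -> differentiable f x) /\
             (forall v : U, Ck k' A (fun x => 'D_v f x))
  end.

Definition smooth_on (R : realType) (U W : normedModType R) (A : set U)
  (f : U -> W) : Prop := forall k, Ck k A f.

(* A homeomorphism from an open subset of M onto an open subset of R^n;
   the values of both maps outside these open sets are irrelevant. *)
Record chart (R : realType) (n : nat) (M : topologicalType) := Chart {
  chart_fun :> M -> 'rV[R]_n ;
  chart_inv : 'rV[R]_n -> M ;
  chart_dom : set M ;
  chart_dom_open : open chart_dom ;
  chart_img_open : open (chart_fun @` chart_dom) ;
  chart_funK : forall x, chart_dom x -> chart_inv (chart_fun x) = x ;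
  chart_fun_continuous :
    forall x, chart_dom x -> {for x, continuous chart_fun} ;
  chart_inv_continuous : forall u, (chart_fun @` chart_dom) u ->
    {for u, continuous chart_inv} }.

(* The smooth structure is given by an atlas indexed by the points of M, the
   chart of index x being defined at x. *)
HB.mixin Record isManifold (R : realType) (n : nat) M of Topological M := {
  chart_at : M -> chart R n M ;
  chart_at_dom : forall x, chart_dom (chart_at x) x ;
  chart_at_smooth : forall x y,
    smooth_on (chart_at x @` (chart_dom (chart_at x) `&` chart_dom (chart_at y)))
              (chart_at y \o chart_inv (chart_at x)) ;
  manifold_hausdorff : hausdorff_space M ;
  manifold_second_countable : @second_countable M
}.

#[short(type="manifoldType")]
HB.structure Definition Manifold (R : realType) (n : nat) :=
  {M of Topological M & isManifold R n M}.

HB.mixin Record isLieGroup (R : realType) (n : nat) G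
    of Manifold R n G & Group G := {
  mulg_continuous : continuous (fun z : G * G => (z.1 * z.2)%g) ;
  mulg_smooth : forall a b c : G,
    smooth_on
      [set w : 'rV[R]_n * 'rV[R]_n |
        [/\ (chart_at a @` chart_dom (chart_at a)) w.1,
            (chart_at b @` chart_dom (chart_at b)) w.2 &
            chart_dom (chart_at c)
              (chart_inv (chart_at a) w.1 * chart_inv (chart_at b) w.2)%g]]
      (fun w => chart_at c
              (chart_inv (chart_at a) w.1 * chart_inv (chart_at b) w.2)%g) ;
  invg_continuous : continuous (fun x : G => (x^-1)%g) ;
  invg_smooth : forall a b : G,
    smooth_on
      [set u : 'rV[R]_n |
        (chart_at a @` chart_dom (chart_at a)) u /\
        chart_dom (chart_at b) ((chart_inv (chart_at a) u)^-1)%g]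
      (fun u => chart_at b ((chart_inv (chart_at a) u)^-1)%g)
}.

#[short(type="lieGroupType")]
HB.structure Definition LieGroup (R : realType) (n : nat) :=
  {G of Manifold R n G & Group G & isLieGroup R n G}.

Section manifold.
Context {R : realType} {n : nat} {M : manifoldType R n}.

(* Vectors and covectors at x are represented by their components in the
   chart of index x. *)
Definition tangent (x : M) : Type := 'rV[R]_n.
Definition cotangent (x : M) : Type := 'cV[R]_n.

(* The components, in the chart c, of a tangent vector and of a covector at a
   point y of its domain. *)
Definition tangent_coord (c : chart R n M) (y : M) (v : tangent y) :
    'rV[R]_n :=
  'd (c \o chart_inv (chart_at y)) (chart_at y y) v.

Definition cotangent_coord (c : chart R n M) (y : M) (p : cotangent y) :
    'cV[R]_n :=
  dual ('d (chart_at y \o chart_inv c) (c y)) p.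

(* The covector at y with components P in the chart c. *)
Definition covector_of_coord (c : chart R n M) (y : M) (P : 'cV[R]_n) :
    cotangent y :=
  dual ('d (c \o chart_inv (chart_at y)) (chart_at y y)) P.

Definition vf_coord (X : forall x : M, tangent x) (c : chart R n M)
    (u : 'rV[R]_n) : 'rV[R]_n :=
  tangent_coord c (X (chart_inv c u)).

Definition smooth_vector_field (X : forall x : M, tangent x) : Prop :=
  forall x, smooth_on (chart_at x @` chart_dom (chart_at x))
                      (vf_coord X (chart_at x)).

(* The bracket of vector fields, with components X(Y^i) - Y(X^i). *)
Definition vf_bracket (X Y : forall x : M, tangent x) (x : M) : tangent x :=
  'd (vf_coord Y (chart_at x)) (chart_at x x) (X x) -
  'd (vf_coord X (chart_at x)) (chart_at x x) (Y x).

(* The derivative at x of a vector-valued function. *)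
Definition fun_diff m (f : M -> 'rV[R]_m) (x : M) (v : tangent x) :
    'rV[R]_m :=
  'd (f \o chart_inv (chart_at x)) (chart_at x x) v.

Definition has_velocity (g : R -> M) (t : R) (v : tangent (g t)) : Prop :=
  {for t, continuous g} /\ is_derive t (1 : R) (chart_at (g t) \o g) v.

Arguments has_velocity : clear implicits.

(* d/dt (delta g) = DF(g) (delta g), in every chart around g t. *)
Definition variational_solution (F : forall x : M, tangent x) (I : set R)
    (g : R -> M) (dg : forall t, tangent (g t)) : Prop :=
  forall t, I t -> has_velocity g t (F (g t)) /\
    forall x, chart_dom (chart_at x) (g t) ->
      is_derive t (1 : R) (fun s => tangent_coord (chart_at x) (dg s))
        ('d (vf_coord F (chart_at x)) (chart_at x (g t))
          (tangent_coord (chart_at x) (dg t))).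

(* dq /\ dp on R^n x (R^n)^* *)
Definition symplectic (z w : 'rV[R]_n * 'cV[R]_n) : R :=
  pairing w.2 z.1 - pairing z.2 w.1.

Definition cotangent_fun_coord (H : forall x : M, cotangent x -> R)
    (c : chart R n M) (z : 'rV[R]_n * 'cV[R]_n) : R :=
  H (chart_inv c z.1) (covector_of_coord c (chart_inv c z.1) z.2).

(* The curve (g, p) has a velocity Z with (dq /\ dp)(Z, -) = dH, in all the
   cotangent charts (q, p) around g t. *)
Definition hamilton_solution (H : forall x : M, cotangent x -> R) (I : set R)
    (g : R -> M) (p : forall t, cotangent (g t)) : Prop :=
  forall t, I t -> {for t, continuous g} /\
    forall x, chart_dom (chart_at x) (g t) ->
      let z s := (chart_at x (g s), cotangent_coord (chart_at x) (p s)) in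
      exists2 Z, is_derive t (1 : R) z Z &
        forall w, symplectic Z w =
                  'd (cotangent_fun_coord H (chart_at x)) (z t) w.

Definition adjoint_hamiltonian (F : forall x : M, tangent x) (x : M)
  (p : cotangent x) : R := pairing p (F x).

Definition adjoint_solution (F : forall x : M, tangent x) :=
  hamilton_solution (adjoint_hamiltonian F).

End manifold.
Arguments has_velocity {R n M} g t v.

(* The tangent map T_x f. *)
Definition tangent_map (R : realType) (m n : nat) (M : manifoldType R m)
    (N : manifoldType R n) (f : M -> N) (x : M) (v : tangent x) :
    tangent (f x) :=
  'd (chart_at (f x) \o f \o chart_inv (chart_at x)) (chart_at x x) v.

Section lie_group.
Context {R : realType} {n : nat} {G : lieGroupType R n}.

Definition lie_algebra : Type := tangent (1%g : G).
Definition lie_coalgebra : Type := cotangent (1%g : G).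

Definition Lmul (g x : G) : G := (g * x)%g.

(* T_e L_g takes its values in the fibre at g * 1, which is g. *)
Definition ltrans (g : G) (xi : lie_algebra) : tangent g :=
  tangent_map (Lmul g) (xi : tangent (1%g : G)).

Definition ltrans_inv (g : G) (v : tangent g) : lie_algebra :=
  tangent_map (Lmul g^-1%g) v.

Definition coltrans (g : G) (p : cotangent g) : lie_coalgebra :=
  dual (ltrans g) p.

Definition coltrans_inv (g : G) : lie_coalgebra -> cotangent g :=
  'pinv_(fun=> 0) [set: 'cV[R]_n] (@coltrans g).

(* The Lie algebra bracket is the bracket of left-invariant vector fields. *)
Definition ad (xi eta : lie_algebra) : lie_algebra :=
  vf_bracket (fun g => ltrans g xi) (fun g => ltrans g eta) 1%g.

Definition coad (xi : lie_algebra) (mu : lie_coalgebra) : lie_coalgebra :=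
  dual (ad xi) mu.

Definition left_trivialization (F : forall g : G, tangent g) (g : G) :
  lie_algebra := ltrans_inv (F g).

Definition lt_adjoint_solution (F : forall g : G, tangent g) (I : set R)
    (g : R -> G) (mu : R -> lie_coalgebra) : Prop :=
  let f := left_trivialization F in
  forall t, I t -> has_velocity g t (F (g t)) /\
    is_derive t (1 : R) mu
      (- coltrans (dual (@fun_diff _ _ _ _ f (g t)) (mu t) : cotangent (g t))
       + coad (f (g t)) (mu t)).

Definition lt_variational_solution (F : forall g : G, tangent g) (I : set R)
    (g : R -> G) (eta : R -> lie_algebra) : Prop :=
  let f := left_trivialization F in
  forall t, I t -> has_velocity g t (F (g t)) /\
    is_derive t (1 : R) eta
      (fun_diff f (ltrans (g t) (eta t)) - ad (f (g t)) (eta t)).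

End lie_group.
Arguments lie_algebra {R n} G.
Arguments lie_coalgebra {R n} G.

(* Main.v *)
Require Import Defs.
From HB Require Import structures.
From mathcomp Require Import all_boot all_order all_algebra.
From mathcomp Require Import all_classical all_reals all_analysis.
Import Order.TTheory GRing.Theory Num.Theory.
Import numFieldNormedType.Exports.
Local Open Scope classical_set_scope.
Local Open Scope ring_scope.

(** The two terms of each trivialized equation are matched by duality: along
    the curve,
      (d/dt) <mu, eta> = - <g^* Df(g)^* mu, eta> + <ad^*_f mu, eta>
                         + <mu, Df(g) (g eta)> - <mu, ad_f eta>,
    and the four terms cancel in pairs.  The cancellation needs only that the
    dual of a linear map A satisfies <A^* p, v> = <p, A v> ([pairing_dual]),
    applied to left translation, to Df(g) and to ad_f.  A differential is
    linear by construction, so the one linearity that has content is that of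
    eta |-> ad_xi eta ([ad_linear]): its value involves the derivative at the
    unit of the components of the left-invariant field generated by eta, and
    the additivity of that derivative in the field rests on the
    differentiability of the fields.  This is where the smoothness of the group
    law enters: by the chain rule the components of the field are a partial
    derivative of the multiplication read in the chart at the unit
    ([differentiable_ltrans_coord]).

    The second pairing is the first one in disguise: g^* (g^{*-1} mu) = mu, so
    that <p, dg> = <g^{*-1} mu, g eta> = <mu, eta> on I.  As the inverse of g^*
    is only chosen on its image, one has to know that g^* is onto, which follows
    from T L_{g^-1} being a left inverse of T_e L_g ([ltransK]), again by the
    chain rule.  The interval I being open, the two functions of time agree
    near every point of it and have the same derivative.

    In both parts the tangent map of a composite goes through the chart chosen
    at the intermediate point, which depends on that point;
    [chain_rule_through_chart] removes it. *)

Set Implicit Arguments.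
Unset Strict Implicit.

(** * Duality between row and column vectors *)

Lemma pairing_dual (R : realType) m n (A : 'rV[R]_m -> 'rV[R]_n)
    (p : 'cV[R]_n) (v : 'rV[R]_m) :
  linear A -> pairing (dual A p) v = pairing p (A v).
Proof.
move=> linA.
pose L : {linear 'rV[R]_m -> 'rV[R]_n} :=
  HB.pack A (GRing.isLinear.Build _ _ _ _ A linA).
rewrite -[A]/(L : _ -> _) /pairing {2}(row_sum_delta v) linear_sum.
under [RHS]eq_bigr do rewrite summxE mulr_sumr.
rewrite exchange_big; apply: eq_bigr => i _.
rewrite mxE /pairing mulr_suml; apply: eq_bigr => j _.
by rewrite (linearZ_LR L) mxE -mulrA [v 0 i * _]mulrC.
Qed.

Lemma pairing_inj (R : realType) n (p q : 'cV[R]_n) :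
  (forall v, pairing p v = pairing q v) -> p = q.
Proof.
have pE (r : 'cV[R]_n) i : pairing r (delta_mx 0 i) = r i 0.
  rewrite /pairing (bigD1 i) //= big1 => [|j /negPf ji].
    by rewrite mxE !eqxx mulr1 addr0.
  by rewrite mxE ji andbF mulr0.
by move=> pq; apply/matrixP => i j; rewrite ord1 -!pE.
Qed.

(** * Calculus *)

Lemma is_derive_entry (R : realType) m n (A : R -> 'M[R]_(m, n)) t dA i j :
  is_derive t (1 : R) A dA -> is_derive t (1 : R) (fun s => A s i j) (dA i j).
Proof.
move=> [dvA <-]; apply: DeriveDef; last by rewrite derive_mx // mxE.
by move/derivable_mxP: dvA; apply.
Qed.

Lemma is_derive_pairing (R : realType) n (p : R -> 'cV[R]_n)
    (v : R -> 'rV[R]_n) t dp dv :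
  is_derive t (1 : R) p dp -> is_derive t (1 : R) v dv ->
  is_derive t (1 : R) (fun s => pairing (p s) (v s))
    (pairing dp (v t) + pairing (p t) dv).
Proof.
move=> /is_derive_entry p_ /is_derive_entry v_.
rewrite (_ : (fun s => _) = \sum_(i < n) (fun s => p s i 0 * v s 0 i)); last first.
  by apply/funext => s; rewrite fct_sumE.
apply: (is_derive_eq (is_derive_sum (fun i => is_deriveM (p_ i 0) (v_ 0 i)))).
rewrite -big_split; apply: eq_bigr => i _ /=.
by rewrite addrC [dp i 0 * _]mulrC.
Qed.

(** The differential depends on the germ only: the expansion of [f] at [x] is
    one of [h], and a linear map with such an expansion is unique. *)
Lemma near_eq_is_diff (R : numFieldType) (V W : normedModType R) (f h : V -> W)
    (x : V) :
  {near x, f =1 h} -> differentiable f x ->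
  differentiable h x /\ 'd h x = 'd f x :> (V -> W).
Proof.
move=> fh df; have [dfc dfE] := (diff_locallyP _ _).1 df.
have fhx : f x = h x := nbhs_singleton fh.
have hE : h \o shift x = cst (h x) + 'd f x +o_ 0 id.
  apply/eqaddoP => e e0; have /eqaddoP/(_ e e0) := dfE.
  apply: filter_app; move: fh; rewrite (near_shift 0) subr0 => fh.
  apply: filter_app fh; apply: nearW => y /= fhy.
  by rewrite -[(h \o _ - _) y]/(h (y + x) - _) -fhy -fhx.
have hf := diff_unique dfc hE.
split; last exact: hf.
by apply/diff_locallyP; rewrite hf.
Qed.

Lemma smooth_on_differentiable (R : realType) (U W : normedModType R)
    (A : set U) (f : U -> W) x :
  smooth_on A f -> A x -> differentiable f x.
Proof. by move=> /(_ 1) [fA _] /fA. Qed.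

Lemma smooth_on_derive_differentiable (R : realType) (U W : normedModType R)
    (A : set U) (f : U -> W) v x :
  smooth_on A f -> A x -> differentiable (fun y => 'D_v f y) x.
Proof. by move=> /(_ 2) [_ /(_ v) [fA _]] /fA. Qed.

(** * Charts *)

Lemma chart_nbhs_dom (R : realType) n (M : topologicalType) (c : chart R n M) x :
  chart_dom c x -> nbhs x (chart_dom c).
Proof. by move=> cx; apply: open_nbhs_nbhs; split=> //; apply: chart_dom_open. Qed.

Lemma chart_nbhs_img (R : realType) n (M : topologicalType) (c : chart R n M) x :
  chart_dom c x -> nbhs (c x) (c @` chart_dom c).
Proof.
move=> cx; apply: open_nbhs_nbhs; split; last by exists x.
exact: chart_img_open.
Qed.

Lemma chart_inv_continuous_at (R : realType) n (M : topologicalType)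
    (c : chart R n M) x :
  chart_dom c x -> {for c x, continuous (chart_inv c)}.
Proof. by move=> cx; apply: chart_inv_continuous; exists x. Qed.

(** Near [u], the map [psi \o phi] factors as [psi \o chart_inv c] after
    [c \o phi], because the continuity of [phi] keeps its values in the domain
    of [c]. *)
Lemma chain_rule_through_chart (R : realType) n (M : topologicalType)
    (U W : normedModType R) (c : chart R n M) (phi : U -> M) (psi : M -> W)
    (u : U) :
  chart_dom c (phi u) -> {for u, continuous phi} ->
  differentiable (c \o phi) u ->
  differentiable (psi \o chart_inv c) (c (phi u)) ->
  'd (psi \o phi) u =
  'd (psi \o chart_inv c) (c (phi u)) \o 'd (c \o phi) u :> (U -> W).
Proof.
move=> cu phic dphi dpsi.
apply: etrans (diff_comp dphi dpsi).
apply: (near_eq_is_diff _ (differentiable_comp dphi dpsi)).2.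
by near=> v; rewrite /= chart_funK //; near: v; apply: phic; exact: chart_nbhs_dom.
Unshelve. all: by end_near. Qed.

Lemma differentiable_transition (R : realType) n (M : manifoldType R n)
    (a b x : M) :
  chart_dom (chart_at a) x -> chart_dom (chart_at b) x ->
  differentiable (chart_at b \o chart_inv (chart_at a)) (chart_at a x).
Proof.
move=> ax bx; apply: (smooth_on_differentiable (chart_at_smooth a b)).
by exists x.
Qed.

(** * Left translation and the adjoint action *)

Section lie_group.
Context {R : realType} {n : nat} {G : lieGroupType R n}.

Definition mulg_coord (a b c : G) (w : 'rV[R]_n * 'rV[R]_n) : 'rV[R]_n :=
  chart_at c (chart_inv (chart_at a) w.1 * chart_inv (chart_at b) w.2)%g.

Lemma Lmul_continuous (g : G) : continuous (Lmul g).
Proof.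
move=> x.
apply: (@continuous_comp _ _ _ (fun y => (g, y)) (fun z : G * G => z.1 * z.2)%g).
  by apply: cvg_pair => /=; [exact: cvg_cst|exact: cvg_id].
exact: mulg_continuous.
Qed.

Lemma Lmul_inv_continuous (b g h : G) : chart_dom (chart_at b) h ->
  {for chart_at b h, continuous (Lmul g \o chart_inv (chart_at b))}.
Proof.
move=> bh; apply: continuous_comp; first exact: chart_inv_continuous_at.
exact: Lmul_continuous.
Qed.

(** Left translation by [g] is the group law with its first argument fixed, read
    in the chart at [g]. *)
Lemma differentiable_Lmul (b c g h : G) :
  chart_dom (chart_at b) h -> chart_dom (chart_at c) (g * h)%g ->
  differentiable (chart_at c \o (Lmul g \o chart_inv (chart_at b)))
    (chart_at b h).
Proof.
move=> bh cgh; have gg := chart_at_dom g.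
rewrite (_ : _ \o _ = mulg_coord g b c \o (fun u => (chart_at g g, u))).
  apply: differentiable_comp; first exact: differentiable_pair.
  apply: (smooth_on_differentiable (mulg_smooth g b c)).
  by split=> /=; rewrite ?chart_funK //; [exists g|exists h].
by apply/funext => u; rewrite /mulg_coord /= chart_funK.
Qed.

(** The chart at [g] replaces the propositionally equal one at [g * 1], in which
    [tangent_map] expresses its value. *)
Lemma ltransE (g : G) (xi : lie_algebra G) :
  ltrans g xi =
  'd (chart_at g \o (Lmul g \o chart_inv (chart_at (1%g : G))))
    (chart_at (1%g : G) 1%g) xi.
Proof. by rewrite /ltrans /tangent_map (mulg1 g : Lmul g 1%g = g). Qed.

(** [ltrans g xi] is given in the chart at [g], which varies with [g]; in a fixed
    chart the left-invariant field becomes an expression that is regular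
    in [g]. *)
Lemma ltrans_chart (c g : G) (xi : lie_algebra G) : chart_dom (chart_at c) g ->
  tangent_coord (chart_at c) (ltrans g xi) =
  'd (chart_at c \o (Lmul g \o chart_inv (chart_at (1%g : G))))
    (chart_at (1%g : G) 1%g) xi.
Proof.
move=> cg; have e1 := chart_at_dom (1%g : G); have gg := chart_at_dom g.
set phi := Lmul g \o _; set u := chart_at 1%g 1%g.
have phiu : phi u = g by rewrite /phi /u /= chart_funK // /Lmul mulg1.
rewrite (@chain_rule_through_chart _ _ _ _ _ (chart_at g) phi).
- by rewrite phiu /= ltransE.
- by rewrite phiu.
- exact: Lmul_inv_continuous.
- by apply: differentiable_Lmul; rewrite ?mulg1.
- by rewrite phiu; exact: differentiable_transition.
Qed.

(** The chain rule applied to [Lmul g^-1 \o Lmul g], which is the identity near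
    the unit. *)
Lemma ltransK (g : G) (xi : lie_algebra G) :
  tangent_map (Lmul g^-1%g) (ltrans g xi) = xi.
Proof.
have e1 := chart_at_dom (1%g : G); have gg := chart_at_dom g.
rewrite /tangent_map (mulVg g : Lmul g^-1%g g = 1%g) ltransE.
set phi := Lmul g \o _; set u := chart_at 1%g 1%g.
have phiu : phi u = g by rewrite /phi /u /= chart_funK // /Lmul mulg1.
pose psi := chart_at (1%g : G) \o Lmul g^-1%g.
have near_id : {near u, id =1 psi \o phi}.
  have := chart_nbhs_img e1; apply: filterS => _ [x ex <-].
  by rewrite /psi /phi /= chart_funK // /Lmul mulKg.
have didE : 'd (psi \o phi) u xi = xi.
  have [_ ->] := near_eq_is_diff near_id (ex_diff (is_diff_def := is_diff_id u)).
  by rewrite diff_val.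
have := @chain_rule_through_chart _ _ _ _ _ (chart_at g) phi psi u.
rewrite phiu => /(_ gg (Lmul_inv_continuous e1)) chain.
have d1 : differentiable (chart_at g \o phi) u.
  by apply: differentiable_Lmul; rewrite ?mulg1.
have d2 : differentiable (psi \o chart_inv (chart_at g)) (chart_at g g).
  by apply: differentiable_Lmul; rewrite ?mulVg.
have {}chain := congr1 (fun h => h xi) (chain d1 d2).
exact: etrans (esym chain) didE.
Qed.

Lemma ltrans_linear (g : G) : linear (ltrans g).
Proof. by move=> a xi eta; rewrite /ltrans /tangent_map linearP. Qed.

Lemma coltransE (g : G) (q : cotangent g) (xi : lie_algebra G) :
  pairing (coltrans q) xi = pairing q (ltrans g xi).
Proof. by apply: pairing_dual; exact: ltrans_linear. Qed.

(** [coltrans_inv g] is a section of [coltrans g] over its image, which is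
    everything: the dual of the left inverse [tangent_map (Lmul g^-1)] of
    [ltrans g] produces a preimage. *)
Lemma coltrans_invK (g : G) (mu : lie_coalgebra G) :
  coltrans (coltrans_inv g mu) = mu.
Proof.
rewrite /coltrans_inv; apply: pinvK; rewrite inE.
exists (dual (@tangent_map _ _ _ _ _ (Lmul g^-1%g) g) mu) => //.
apply: pairing_inj => xi; rewrite coltransE pairing_dual ?ltransK //.
by move=> a v w; rewrite /tangent_map linearP.
Qed.

(** In the chart [c] at the unit, the components at [u] of the left-invariant
    field generated by [xi] are the derivative of the group law at [(u, c 1)] in
    the direction [(0, xi)]; they are differentiable in [u] since the group law
    is of class C^2. *)
Lemma differentiable_ltrans_coord (xi : lie_algebra G) :
  let c := chart_at (1%g : G) in
  differentiable (vf_coord (fun g => ltrans g xi) c) (c 1%g).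
Proof.
move=> c; have e1 := chart_at_dom (1%g : G).
set u0 := c 1%g; pose m := mulg_coord (1%g : G) 1%g 1%g.
have u0E : chart_inv c u0 = 1%g by exact: chart_funK.
have dm u : (c @` chart_dom c) u -> differentiable m (u, u0).
  move=> [x ex <-]; apply: (smooth_on_differentiable (mulg_smooth _ _ _)).
  by split=> /=; [exists x|exists 1%g|rewrite -/c chart_funK // u0E mulg1].
apply: (near_eq_is_diff (f := fun u => 'D_(0, xi) m (u, u0)) _ _).1.
  have := chart_nbhs_img e1; apply: filterS => u cu; rewrite deriveE; last exact: dm.
  case: (cu) => x ex xu; rewrite /vf_coord ltrans_chart -xu chart_funK // xu.
  have -> : chart_at 1%g \o (Lmul x \o chart_inv (chart_at (1%g : G))) =
            m \o (fun v => (u, v)).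
    by apply/funext => v; rewrite /m /mulg_coord /= -xu chart_funK.
  have dpair : is_diff u0 (fun v => (u, v)) (fun v => (0, v)).
    exact: is_diff_pair (is_diff_cst u u0) (is_diff_id u0).
  have dmu := differentiableP (dm u cu).
  have dcomp : is_diff u0 (m \o fun v => (u, v))
      ('d m (u, u0) \o fun v => (0, v)) by exact: is_diff_comp.
  exact: (esym (congr1 (fun h => h xi) (diff_val (is_diff_def := dcomp)))).
apply: (differentiable_comp (f := fun u => (u, u0))
  (g := fun w => 'D_(0, xi) m w)); first exact: differentiable_pair.
apply: (smooth_on_derive_differentiable _ (mulg_smooth _ _ _)).
by split=> /=; [exists 1%g|exists 1%g|rewrite -/c u0E mulg1].
Qed.

(** Of the two terms of the bracket of left-invariant fields, one is linear in
    [eta] as a value of a differential; the other one differentiates the field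
    generated by [eta], and is linear because these fields are differentiable
    and depend linearly on [eta]. *)
Lemma ad_linear (xi : lie_algebra G) : linear (ad xi).
Proof.
move=> a eta zeta; set c := chart_at (1%g : G).
pose V (xi' : lie_algebra G) := vf_coord (fun g => ltrans g xi') c.
pose v : 'rV[R]_n := ltrans (1%g : G) xi.
have VE : V (a *: eta + zeta) = a *: V eta + V zeta.
  apply/funext => u; rewrite /V /vf_coord ltrans_linear.
  exact: linearP.
have dV xi' := differentiableP (differentiable_ltrans_coord xi').
have dVE : is_diff (c 1%g) (V (a *: eta + zeta))
    (a *: ('d (V eta) (c 1%g) : 'rV[R]_n -> 'rV[R]_n) + 'd (V zeta) (c 1%g)).
  by rewrite VE; apply: is_diffD (is_diffZ _ (dV eta)) (dV zeta).
have left_part := congr1 (fun h => h v) (diff_val (is_diff_def := dVE)).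
pose dVxi := 'd (V xi) (c 1%g); pose L1 := @ltrans _ _ G 1%g.
have right_part : dVxi (L1 (a *: eta + zeta)) =
    a *: dVxi (L1 eta) + dVxi (L1 zeta).
  exact: etrans (congr1 dVxi (ltrans_linear 1%g a eta zeta)) (linearP _ _ _ _).
apply: etrans (congr2 (fun x y => x - y) left_part right_part) _.
by rewrite opprD addrACA -scalerBr.
Qed.

End lie_group.

(** * Conservation of the pairing *)

Lemma fun_diff_linear (R : realType) m n (M : manifoldType R n)
    (f : M -> 'rV[R]_m) (x : M) : linear (@fun_diff _ _ _ _ f x).
Proof. by move=> a v w; exact: linearP. Qed.

Lemma pairing_adjoint_cancel (R : realType) n (p a b : 'cV[R]_n)
    (v c d : 'rV[R]_n) :
  pairing a v = pairing p c -> pairing b v = pairing p d ->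
  pairing (- a + b) v + pairing p (c - d) = 0.
Proof.
have -> : pairing (- a + b) v = pairing b v - pairing a v.
  by rewrite /pairing -sumrB; apply: eq_bigr => i _; rewrite !mxE addrC mulrBl.
have -> : pairing p (c - d) = pairing p c - pairing p d.
  by rewrite /pairing -sumrB; apply: eq_bigr => i _; rewrite !mxE mulrBr.
by move=> -> ->; rewrite addrA subrK subrr.
Qed.

Unset Implicit Arguments.
Set Strict Implicit.

Theorem theorem3p1 (R : realType) (n : nat) (G : lieGroupType R n)
    (F : forall x : G, tangent x) (I : set R) (g : R -> G)
    (mu : R -> lie_coalgebra G) (eta : R -> lie_algebra G)
    (p : forall t, cotangent (g t)) (dg : forall t, tangent (g t)) :
  smooth_vector_field F ->
  open I -> is_interval I ->
  lt_adjoint_solution F I g mu ->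
  lt_variational_solution F I g eta ->
  (forall t, I t -> p t = coltrans_inv (g t) (mu t)) ->
  (forall t, I t -> dg t = ltrans (g t) (eta t)) ->
  adjoint_solution F I p ->
  variational_solution F I dg ->
  forall t, I t ->
    is_derive t (1 : R) (fun s => pairing (mu s) (eta s)) 0 /\
    is_derive t (1 : R) (fun s => pairing (p s) (dg s)) 0.
Proof.
move=> _ openI _ adj var pE dgE _ _ t It.
have dmueta : is_derive t (1 : R) (fun s => pairing (mu s) (eta s)) 0.
  have [_ dmu] := adj t It; have [_ deta] := var t It.
  apply: (is_derive_eq (is_derive_pairing dmu deta)).
  apply: pairing_adjoint_cancel.
    apply: etrans (coltransE _ _) _.
    by apply: pairing_dual; exact: fun_diff_linear.
  by apply: pairing_dual; exact: ad_linear.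
split=> //; apply: near_eq_is_derive dmueta.
have : nbhs t I by apply: open_nbhs_nbhs.
by apply: filterS => s Is; rewrite pE // dgE // -coltransE coltrans_invK.
Qed.
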